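(* Let $n\ge5$. If $G$ is a connected graph of order $n$ with exactly $3$ pendant vertices such that $\rho_Q(G)\ge\rho_Q(G')$ for every connected graph $G'$ of order $n$ with exactly $3$ pendant vertices, then $G\cong T(n,3;1,2)$.
   Context: All graphs are simple and finite. For a connected graph $G$ with vertex set $\{v_1,\dots,v_n\}$, $d_G(u,v)$ is the distance, $Tr_G(u)=\sum_{v}d_G(u,v)$ is the transmission, $Tr(G)$ is the diagonal matrix of transmissions and $D(G)=(d_G(v_i,v_j))$ is the distance matrix. The distance signless Laplacian matrix is $Q_D(G)=Tr(G)+D(G)$ and $\rho_Q(G)$ is its largest eigenvalue. A pendant vertex is a vertex of degree $1$. $T(n,3;1,2)$ is the tree obtained from a path of order $n-3$ by attaching one pendant vertex to one end vertex of the path and two pendant vertices to the other end vertex. *)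

(* Defs.v *)
From mathcomp Require Import all_boot all_order all_algebra.
From mathcomp Require Import classical_sets reals.
Set Implicit Arguments.
Unset Strict Implicit.
Unset Printing Implicit Defensive.
Import Order.TTheory GRing.Theory Num.Theory.

Record sgraph (n : nat) := SGraph {
  adj :> rel 'I_n;
  adj_sym : symmetric adj;
  adj_irr : irreflexive adj
}.

Definition connected_graph n (G : sgraph n) : Prop :=
  forall u v : 'I_n, connect G u v.

Definition degree n (G : sgraph n) (u : 'I_n) : nat := #|[set v | G u v]|.

Definition pendants n (G : sgraph n) : {set 'I_n} := [set u | degree G u == 1].

Definition isomorphic n (G H : sgraph n) : Prop :=
  exists2 f : 'I_n -> 'I_n, bijective f & forall u v, H (f u) (f v) = G u v.

Definition walk_of_length n (G : sgraph n) (u v : 'I_n) (k : nat) : bool :=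
  [exists p : k.-tuple 'I_n, path G u p && (last u p == v)].

(* The least length of a walk from u to v. In a graph of order n a shortest
   walk has length less than n; the value is n when v is unreachable. *)
Definition dist n (G : sgraph n) (u v : 'I_n) : nat :=
  find (walk_of_length G u v) (iota 0 n).

Definition transmission n (G : sgraph n) (u : 'I_n) : nat :=
  \sum_(v < n) dist G u v.

Section DistanceSignlessLaplacian.
Variable R : realType.
Local Open Scope ring_scope.

Definition distance_mx n (G : sgraph n) : 'M[R]_n :=
  \matrix_(i, j) (dist G i j)%:R.

Definition transmission_mx n (G : sgraph n) : 'M[R]_n :=
  diag_mx (\row_i (transmission G i)%:R).

Definition dsl_mx n (G : sgraph n) : 'M[R]_n :=
  transmission_mx G + distance_mx G.

(* The supremum is a maximum for n > 0: the matrix is real symmetric, so its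
   set of eigenvalues in R is finite and nonempty. *)
Definition rhoQ n (G : sgraph n) : R :=
  sup [set a : R | eigenvalue (dsl_mx G) a]%classic.

End DistanceSignlessLaplacian.

(* The path is 0, 1, ..., n - 4; the pendant vertex n - 3 is attached to its
   end 0, and the pendant vertices n - 2 and n - 1 to its end n - 4. *)
Definition tree12_arc (n i j : nat) : bool :=
  [|| (j == i.+1) && (j < n - 3),
      (i == 0) && (j == n - 3)
    | (i == n - 4) && ((j == n - 2) || (j == n - 1))].

(* The condition i != j only matters for n < 4. *)
Definition tree12_adj n : rel 'I_n :=
  fun i j => (i != j) && (tree12_arc n i j || tree12_arc n j i).

Lemma tree12_sym n : symmetric (@tree12_adj n).
Proof. by move=> i j; rewrite /tree12_adj eq_sym orbC. Qed.

Lemma tree12_irr n : irreflexive (@tree12_adj n).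
Proof. by move=> i; rewrite /tree12_adj eqxx. Qed.

(* T(n,3;1,2) *)
Definition tree12 n : sgraph n := SGraph (@tree12_sym n) (@tree12_irr n).

(* Main.v *)
(* With the energy of a graph G at a vector x > 0 defined as the sum of
   d(u,v) (x_u + x_v)^2 over all pairs (u, v), x^T Q_D(G) x is half the energy
   and rho_Q(G) is the maximal Rayleigh quotient, attained at a positive
   vector x. Fix the x of the given G, and let M maximise the energy at x
   among connected graphs with at least 3 pendant vertices.
   - Deleting a non-bridge lengthens distances and keeps pendant vertices, so
     every edge of M is a bridge.
   - If y has neighbours h, z1, z2, reattach the branch at h from y to z1 or to
     z2. Since d(z1,v) + d(z2,v) >= 2 d(y,v) for every v, the two new energies
     add up to more than twice the old one and one of the moves increases the
     energy; by maximality one of them must destroy a pendant vertex (z1 or z2)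
     and leave fewer than 3.
   Hence M has exactly 3 pendant vertices, and a vertex of degree at least 3
   has at most one non-pendant neighbour, which forces M to be T(n,3;1,2). As M
   competes with G for rho_Q, the graph G has the same energy as M and is
   a maximiser too. *)
Require Import Defs.
From mathcomp Require Import all_boot all_order all_algebra.
From mathcomp Require Import classical_sets reals.
From mathcomp Require Import boolp.
(* finset again, so that its lemmas shadow their namesakes in classical_sets. *)
From mathcomp Require Import fintype finset zify ring lra.
Import Order.TTheory GRing.Theory Num.Theory.

(** * Walks, shortest paths and distances *)

Section Distance.
Set Implicit Arguments.
Unset Strict Implicit.
Variables (n : nat) (G : sgraph n).

Lemma dist_le_size u v p : path G u p -> last u p = v -> dist G u v <= size p.
Proof.
move=> pp lp; rewrite /dist leqNgt; apply/negP => lt.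
(* [dist] is at most [n], the length of the searched list, so a walk shorter than [dist] has its
   length in that list. *)
have ltn : size p < n.
  by apply: leq_trans lt _; rewrite -[leqRHS](size_iota 0) find_size.
have := before_find 0 lt; rewrite nth_iota // add0n /walk_of_length.
by move/existsP; apply; exists (in_tuple p); rewrite /= pp lp eqxx.
Qed.

Lemma dist_lipschitz (f : 'I_n -> nat) k u p :
  (forall s t, G s t -> f t <= (f s).+1) ->
  path G u p -> f u <= k -> f (last u p) <= k + size p.
Proof.
move=> lip; elim: p u k => [|t p IH] u k /=; first by rewrite addn0.
case/andP=> ut pp fu; rewrite addnS -addSn; apply: IH pp _.
exact: leq_trans (lip _ _ ut) _.
Qed.

Lemma distxx u : dist G u u = 0.
Proof. by apply/eqP; rewrite -leqn0; apply: (@dist_le_size u u [::]). Qed.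

Lemma adj_neq u v : G u v -> u != v.
Proof. by apply: contraTN => /eqP->; rewrite adj_irr. Qed.

Lemma dist_adj_le1 u v : G u v -> dist G u v <= 1.
Proof. by move=> uv; apply: (@dist_le_size u v [:: v]); rewrite /= ?uv. Qed.

Hypothesis cG : connected_graph G.

Lemma shortest_path u v :
  exists p, [/\ path G u p, last u p = v & size p = dist G u v].
Proof.
have [p pp ep] := connectP (cG u v).
case: (shortenP pp) ep => p' pp' up' _ ep.
have sp' : size p' < n.
  by have := max_card (mem (u :: p')); rewrite card_ord (card_uniqP up').
have hw : has (walk_of_length G u v) (iota 0 n).
  apply/hasP; exists (size p'); first by rewrite mem_iota add0n.
  by apply/existsP; exists (in_tuple p'); rewrite /= pp' ep eqxx.
have := nth_find 0 hw; rewrite nth_iota ?add0n; last first.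
  by rewrite -[ltnRHS](size_iota 0) -has_find.
case/existsP=> q /andP[pq /eqP lq].
by exists q; split=> //; rewrite size_tuple.
Qed.

(** Serves to bound distances from below: along a shortest path from [u] such an [f] gains at most
    one per edge. *)
Lemma lipschitz_le_dist (f : 'I_n -> nat) u v :
  (forall s t, G s t -> f t <= (f s).+1) -> f u = 0 -> f v <= dist G u v.
Proof.
move=> lip fu; have [p [pp <- <-]] := shortest_path u v.
by apply: (@dist_lipschitz f 0) => //; rewrite fu.
Qed.

Lemma dist_triangle u v w : dist G u w <= dist G u v + dist G v w.
Proof.
have [p [pp ep <-]] := shortest_path u v.
have [q [pq eq <-]] := shortest_path v w.
by rewrite -size_cat; apply: dist_le_size; rewrite ?cat_path ?last_cat ep // pp.
Qed.

Lemma dist_adj_r u v w : G v w -> dist G u w <= (dist G u v).+1.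
Proof.
move=> vw; apply: leq_trans (dist_triangle u v w) _.
by rewrite -addn1 leq_add2l dist_adj_le1.
Qed.

Lemma dist_sym u v : dist G u v = dist G v u.
Proof.
wlog suff : u v / dist G u v <= dist G v u => [sf|].
  by apply/eqP; rewrite eqn_leq !sf.
have [p [pp <- <-]] := shortest_path v u.
rewrite -(size_belast v) -size_rev; apply: dist_le_size.
  by rewrite rev_path (eq_path (e' := G)) // => s t; rewrite adj_sym.
by case: p pp => //= t p _; rewrite rev_cons last_rcons.
Qed.

Lemma dist_eq0 u v : (dist G u v == 0) = (u == v).
Proof.
apply/eqP/eqP => [|->]; last exact: distxx.
by have [p [_ <- <-]] := shortest_path u v; case: p.
Qed.

Lemma dist_adj u v : G u v -> dist G u v = 1.
Proof.
move=> uv; apply/eqP; rewrite eqn_leq dist_adj_le1 //= lt0n dist_eq0.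
exact: adj_neq.
Qed.

Lemma dist1_adj u v : dist G u v = 1 -> G u v.
Proof.
have [p [pp ep sp]] := shortest_path u v => d1; move: sp; rewrite d1.
by case: p pp ep => [|t []] //= /andP[+ _] => /[swap] ->.
Qed.

Lemma closer_neighbour u v : u != v ->
  exists2 t, G t v & dist G u v = (dist G u t).+1.
Proof.
have [p [pp ep sp]] := shortest_path u v.
case/lastP: p pp ep sp => [|p w]; first by move=> _ /= ->; rewrite eqxx.
rewrite rcons_path last_rcons size_rcons => /andP[pp tw] ew sp _; subst w.
exists (last u p) => //; apply/eqP; rewrite eqn_leq dist_adj_r //=.
by rewrite -sp ltnS; apply: dist_le_size.
Qed.

Lemma dist_intermediate u v k : k <= dist G u v -> exists t, dist G u t = k.
Proof.
move: {2}(dist G u v) (erefl (dist G u v)) => m.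
elim: m v => [|m IH] v em; rewrite em.
  by rewrite leqn0 => /eqP->; exists v; rewrite em.
rewrite leq_eqVlt => /orP[/eqP->|]; first by exists v; rewrite em.
rewrite ltnS => km.
have [t _ et] : exists2 t, G t v & dist G u v = (dist G u t).+1.
  by apply: closer_neighbour; rewrite -dist_eq0 em.
by apply: (IH t); move: et; rewrite em; lia.
Qed.

End Distance.

(** * Edge deletion and its effect on pendant vertices and distances *)

Section EdgeOperations.
Set Implicit Arguments.
Unset Strict Implicit.
Variable n : nat.
Implicit Types G : sgraph n.

Lemma pendantP G u :
  reflect (exists2 v, G u v & forall w, G u w -> w = v) (u \in pendants G).
Proof.
rewrite inE; apply: (iffP cards1P) => [[v eN]|[v uv uN]].
  exists v => [|w uw]; first by have := set11 v; rewrite -eN inE.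
  by apply/set1P; rewrite -eN inE.
exists v; apply/setP=> w; rewrite !inE.
by apply/idP/eqP => [/uN|->].
Qed.

Lemma connect_ind G (P : 'I_n -> bool) u v :
  (forall s t, G s t -> P s -> P t) -> connect G u v -> P u -> P v.
Proof.
move=> PG /connectP[p]; elim: p u => [|t p IH] u /=; first by move=> _ ->.
by case/andP=> ut pp ep Pu; apply: IH pp ep (PG _ _ ut Pu).
Qed.

Lemma connectC G u v : connect G u v = connect G v u.
Proof. by apply: sym_connect_sym; apply: adj_sym. Qed.

Lemma connected_from G r : (forall u, connect G r u) -> connected_graph G.
Proof. by move=> cr u v; apply: connect_trans (cr v); rewrite connectC. Qed.

Definition same_edge (a b i j : 'I_n) :=
  (i == a) && (j == b) || (i == b) && (j == a).

Lemma same_edgeC a b i j : same_edge a b i j = same_edge a b j i.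
Proof. by rewrite /same_edge orbC [(j == b) && _]andbC [(j == a) && _]andbC. Qed.

Definition del_adj G (a b : 'I_n) : rel 'I_n :=
  fun i j => G i j && ~~ same_edge a b i j.

Lemma del_adj_sym G a b : symmetric (del_adj G a b).
Proof. by move=> i j; rewrite /del_adj adj_sym same_edgeC. Qed.

Lemma del_adj_irr G a b : irreflexive (del_adj G a b).
Proof. by move=> i; rewrite /del_adj adj_irr. Qed.

Definition del_edge G a b : sgraph n :=
  SGraph (@del_adj_sym G a b) (@del_adj_irr G a b).

Definition add_adj G (a b : 'I_n) : rel 'I_n :=
  fun i j => (i != j) && (G i j || same_edge a b i j).

Lemma add_adj_sym G a b : symmetric (add_adj G a b).
Proof. by move=> i j; rewrite /add_adj adj_sym same_edgeC eq_sym. Qed.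

Lemma add_adj_irr G a b : irreflexive (add_adj G a b).
Proof. by move=> i; rewrite /add_adj eqxx. Qed.

Definition add_edge G a b : sgraph n :=
  SGraph (@add_adj_sym G a b) (@add_adj_irr G a b).

Lemma del_edge_sub G a b i j : del_edge G a b i j -> G i j.
Proof. by case/andP. Qed.

Lemma del_edgeF G a b : del_edge G a b a b = false.
Proof. by rewrite /= /del_adj /same_edge !eqxx andbF. Qed.

Lemma del_edge_connect_or G a b u :
  connected_graph G -> connect (del_edge G a b) a u || connect (del_edge G a b) b u.
Proof.
move=> cG; pose P v := connect (del_edge G a b) a v || connect (del_edge G a b) b v.
apply: (@connect_ind G P a u _ (cG a u)); last by rewrite /P connect0.
move=> s t st /orP cs; rewrite /P.
case: (boolP (same_edge a b s t)) => [|nst].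
  by case/orP=> /andP[_ /eqP->]; rewrite connect0 ?orbT.
have dst : del_edge G a b s t by rewrite /= /del_adj st.
by apply/orP; case: cs => cs; [left|right]; apply: connect_trans cs (connect1 dst).
Qed.

Definition bridge G a b := ~~ connect (del_edge G a b) a b.

Lemma nonbridge_del_connected G a b :
  connected_graph G -> ~~ bridge G a b -> connected_graph (del_edge G a b).
Proof.
move=> cG /negPn cab; apply: (connected_from (r := a)) => u.
case/orP: (del_edge_connect_or a b u cG) => // cb.
exact: connect_trans cab cb.
Qed.

(** A pendant vertex that loses its edge would be isolated, against the connectedness of the
    remaining graph. *)
Lemma del_edge_pendants G a b : G a b ->
  connected_graph (del_edge G a b) ->
  pendants G \subset pendants (del_edge G a b).
Proof.
move=> ab cD; apply/subsetP=> u /pendantP[v uv uN].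
have ne : a != b by apply: contraTN ab => /eqP->; rewrite adj_irr.
have nse w : G u w -> ~~ same_edge a b u w.
  move=> uw; apply/negP=> se.
  have cl c : c != u -> exists2 t, G t u & ~~ same_edge a b t u.
    by case/(closer_neighbour cD) => t /andP[tu nt] _; exists t.
  have [t tu nt] : exists2 t, G t u & ~~ same_edge a b t u.
    by case/orP: se => /andP[/eqP eu _]; [apply: (cl b)|apply: (cl a)];
       rewrite eu // eq_sym.
  move/negP: nt; apply; rewrite same_edgeC.
  by rewrite (uN t) ?[G u t]adj_sym // -(uN w uw).
apply/pendantP; exists v; first by rewrite /= /del_adj uv nse.
by move=> w /del_edge_sub /uN.
Qed.

Lemma del_edge_dist G a b u v :
  connected_graph G -> connected_graph (del_edge G a b) ->
  dist G u v <= dist (del_edge G a b) u v.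
Proof.
move=> cG cD; apply: (lipschitz_le_dist cD) (distxx G u) => s t.
by move/del_edge_sub; apply: dist_adj_r.
Qed.

Lemma del_edge_dist_lt G a b : G a b ->
  connected_graph G -> connected_graph (del_edge G a b) ->
  dist G a b < dist (del_edge G a b) a b.
Proof.
move=> ab cG cD; rewrite ltn_neqAle del_edge_dist // andbT.
apply/eqP; rewrite (dist_adj cG ab) => /esym /(dist1_adj cD).
by rewrite del_edgeF.
Qed.

(* The left-hand side is a function of v that vanishes at u and is
   1-Lipschitz along the edges of G', hence at most the distance from u. *)
Lemma cut_dist_le G G' (side : pred 'I_n) h z u v :
  connected_graph G -> connected_graph G' -> ~~ side z ->
  (forall s t, G' s t -> side s = side t -> G s t) ->
  (forall s t, G' s t -> side s -> ~~ side t -> s = h /\ t = z) ->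
  side u ->
  (if side v then dist G u v else dist G u h + (dist G z v).+1) <= dist G' u v.
Proof.
move=> cG cG' sz inner cross su.
apply: (@lipschitz_le_dist _ _ cG'
  (fun v => if side v then dist G u v else dist G u h + (dist G z v).+1)); last first.
  by rewrite su distxx.
move=> s t st; case: ifP => Ht; case: ifP => Hs.
- by apply: dist_adj_r => //; apply: inner st _; rewrite Hs Ht.
- have [-> _] : t = h /\ s = z by apply: cross; rewrite 1?adj_sym ?Ht ?Hs.
  lia.
- have [-> ->] := cross _ _ st Hs (negbT Ht).
  by rewrite distxx; lia.
- have /(dist_adj_r cG z) : G s t by apply: inner st _; rewrite Hs Ht.
  lia.
Qed.

(** Off [side], the cut bound is applied to the complement with the roles of [h] and [z]
    exchanged. *)
Lemma cut_dist_le_inner G G' (side : pred 'I_n) h z u v :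
  connected_graph G -> connected_graph G' -> side h -> ~~ side z ->
  (forall s t, G' s t -> side s = side t -> G s t) ->
  (forall s t, G' s t -> side s -> ~~ side t -> s = h /\ t = z) ->
  side u = side v -> dist G u v <= dist G' u v.
Proof.
move=> cG cG' sh sz inner cross; case: (boolP (side u)) => su sv.
  by have := cut_dist_le v cG cG' sz inner cross su; rewrite -sv.
have := @cut_dist_le G G' (fun w => ~~ side w) z h u v cG cG'.
rewrite -sv; apply=> //; first by rewrite sh.
- by move=> s t st; move/(congr1 negb); rewrite !negbK; apply: inner.
- by move=> s t st ns /negPn ht; have [] := cross t s _ ht ns; rewrite 1?adj_sym.
Qed.

(** * Branches at a bridge *)

Definition side G a b : pred 'I_n := connect (del_edge G a b) b.

Lemma side_cross G a b s t : bridge G a b ->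
  G s t -> side G a b s -> ~~ side G a b t -> s = b /\ t = a.
Proof.
move=> br st ss nt.
have : same_edge a b s t.
  apply: contraNT nt => nst; apply: connect_trans ss (connect1 _).
  by rewrite /= /del_adj st.
case/orP=> /andP[/eqP es /eqP et] //; subst s.
by move: br; rewrite /bridge connectC -/(side G a b a) ss.
Qed.

(** The triangle inequality through [b] and [a] gives one direction, the cut bound with [G] compared
    to itself the other. *)
Lemma bridge_dist G a b u v : connected_graph G -> bridge G a b -> G a b ->
  side G a b u -> ~~ side G a b v ->
  dist G u v = dist G u b + (dist G a v).+1.
Proof.
move=> cG br ab su nv; apply/eqP; rewrite eqn_leq; apply/andP; split.
  apply: leq_trans (dist_triangle cG u b v) _; rewrite leq_add2l.
  apply: leq_trans (dist_triangle cG b a v) _.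
  by rewrite (@dist_adj _ _ cG b a) // adj_sym.
have := @cut_dist_le G G (side G a b) b a u v cG cG.
rewrite (negbTE nv); apply=> //; first by rewrite /side connectC.
by move=> s t; apply: side_cross.
Qed.

(** From [v], one end of the bridge is reached only through the other. This plays the part of the
    bipartiteness of trees. *)
Lemma bridge_dist_neq G a b v : connected_graph G -> bridge G a b -> G a b ->
  dist G v a != dist G v b.
Proof.
move=> cG br ab.
have sb : side G a b b by rewrite /side connect0.
have na : ~~ side G a b a by rewrite /side connectC.
case: (boolP (side G a b v)) => sv.
  by rewrite (bridge_dist cG br ab sv na) distxx; lia.
by rewrite ![dist G v _](dist_sym cG) (bridge_dist cG br ab sb sv) distxx; lia.
Qed.

(** If [u] is closer to [v] than [y] is, then [v] lies in the branch at [u]. Another neighbour [u']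
    lies outside that branch, so [v] reaches it only across the bridge and it is farther than
    [y]. *)
Lemma closer_unique G y u u' v :
  connected_graph G -> bridge G y u -> G y u -> G y u' ->
  dist G v u < dist G v y -> dist G v u' <= dist G v y -> u' = u.
Proof.
move=> cG br yu yu' cl cl'; apply/eqP; apply: contraTT cl' => ne.
have su : side G y u u by rewrite /side connect0.
have ny : ~~ side G y u y by rewrite /side connectC.
have sv : side G y u v.
  apply: contraTT cl => sv.
  by rewrite ![dist G v _](dist_sym cG) (bridge_dist cG br yu su sv) distxx; lia.
have nu' : ~~ side G y u u'.
  apply/negP=> su'; move/eqP: ne; apply.
  by have [] := side_cross br _ su' ny; rewrite 1?adj_sym.
rewrite (bridge_dist cG br yu sv nu') (dist_adj cG yu') -ltnNge.
by have := dist_adj_r cG v (v := u) (w := y); rewrite adj_sym => /(_ yu); lia.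
Qed.

(** * Reattaching the branch at [h] from [y] to [z] *)

Definition move_edge G y h z := add_edge (del_edge G y h) z h.

Section Move.
Variables (G : sgraph n) (y h z : 'I_n).
Hypotheses (cG : connected_graph G) (br : bridge G y h).
Hypotheses (yh : G y h) (yz : G y z) (zh : z != h).

Let G' := move_edge G y h z.

Lemma move_edge_new : G' z h.
Proof. by rewrite /= /add_adj zh /same_edge !eqxx orbT. Qed.

Lemma move_edge_old s t : del_edge G y h s t -> G' s t.
Proof.
move=> st; rewrite /= /add_adj.
have -> : s != t by apply: contraTN st => /eqP->; rewrite adj_irr.
by rewrite /= -[del_adj _ _ _ _ _]/(del_edge G y h s t) st.
Qed.

Lemma move_edge_connected : connected_graph G'.
Proof.
have sub s t : connect (del_edge G y h) s t -> connect G' s t.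
  by apply: connect_sub => i j ij; apply/connect1/move_edge_old.
apply: (connected_from (r := y)) => u.
case/orP: (del_edge_connect_or y h u cG) => /sub // hu.
(* The edge [yz] survives because [z != h], so [y] reaches [h] through [z] and the new edge. *)
apply: connect_trans hu; apply: (@connect_trans _ _ z); last exact/connect1/move_edge_new.
apply/connect1/move_edge_old; rewrite /= /del_adj yz /same_edge (negbTE zh) andbF /=.
by apply/negP=> /andP[/eqP e _]; move: yh; rewrite e adj_irr.
Qed.

Lemma move_edge_side_z : ~~ side G y h z.
Proof.
apply/negP=> sz; move/negP: br; apply; rewrite connectC.
apply: connect_trans sz (connect1 _); rewrite /= /del_adj adj_sym yz /same_edge.
rewrite (negbTE zh) /= orbF.
by apply/negP=> /andP[_ /eqP e]; move: yh; rewrite e adj_irr.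
Qed.

Lemma move_edgeP s t : G' s t -> del_edge G y h s t \/ same_edge z h s t.
Proof. by case/andP=> _ /orP. Qed.

Let sh : side G y h h. Proof. by rewrite /side connect0. Qed.

Lemma move_edge_inner s t : G' s t -> side G y h s = side G y h t -> G s t.
Proof.
case/move_edgeP=> [/del_edge_sub //|].
case/orP=> /andP[/eqP-> /eqP->]; first by rewrite sh (negbTE move_edge_side_z).
by rewrite sh (negbTE move_edge_side_z).
Qed.

Lemma move_edge_cross s t :
  G' s t -> side G y h s -> ~~ side G y h t -> s = h /\ t = z.
Proof.
case/move_edgeP=> [st ss /negP[]|].
  exact: connect_trans ss (connect1 st).
case/orP=> /andP[/eqP-> /eqP->] //.
by rewrite (negbTE move_edge_side_z).
Qed.

Lemma move_edge_dist_inner u v :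
  side G y h u = side G y h v -> dist G u v <= dist G' u v.
Proof.
exact: cut_dist_le_inner cG move_edge_connected sh move_edge_side_z
  move_edge_inner move_edge_cross.
Qed.

Lemma move_edge_dist_cross u v : side G y h u -> ~~ side G y h v ->
  dist G u h + (dist G z v).+1 <= dist G' u v.
Proof.
move=> su /negbTE sv.
have := cut_dist_le v cG move_edge_connected move_edge_side_z
  move_edge_inner move_edge_cross su.
by rewrite sv.
Qed.


(** A pendant [h] exchanges its neighbour [y] for [z], and vertices other than [y], [z], [h] keep
    their neighbours. As [y] is not pendant, only [z] can be lost. *)
Lemma move_edge_pendants (y_npend : y \notin pendants G) :
  pendants G :\ z \subset pendants G'.
Proof.
apply/subsetP=> u /setD1P[uz pu].
have uy : u != y by apply: contraNneq y_npend => <-.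
move: pu => /pendantP[v uv uN]; apply/pendantP.
case: (eqVneq u h) => [eh|uh].
  have ey : v = y by apply/esym/uN; rewrite eh adj_sym.
  exists z => [|w]; first by rewrite eh adj_sym move_edge_new.
  case/move_edgeP=> [/andP[uw]|].
    by rewrite (uN _ uw) ey eh same_edgeC /same_edge !eqxx.
  by case/orP=> /andP[/eqP e /eqP ew] //; move: uz; rewrite e eqxx.
exists v => [|w].
  by apply: move_edge_old; rewrite /= /del_adj uv /same_edge (negbTE uy) (negbTE uh).
case/move_edgeP=> [/del_edge_sub /uN //|].
by rewrite /same_edge (negbTE uz) (negbTE uh).
Qed.

End Move.

(** * Two alternative moves of one branch *)

Section TwoMoves.
Variables (G : sgraph n) (y h z1 z2 : 'I_n).
Hypotheses (cG : connected_graph G) (br : forall a b, G a b -> bridge G a b).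
Hypotheses (yh : G y h) (yz1 : G y z1) (yz2 : G y z2).
Hypotheses (z1h : z1 != h) (z2h : z2 != h) (z12 : z1 != z2).

(* In a tree at most one of z1, z2 is closer to v than y is. *)
Lemma two_moves_convex v : (dist G y v).*2 <= dist G z1 v + dist G z2 v.
Proof.
rewrite ![dist G _ v](dist_sym cG).
have d1 := bridge_dist_neq v cG (br yz1) yz1.
have d2 := bridge_dist_neq v cG (br yz2) yz2.
have l1 := dist_adj_r cG v (v := z1) (w := y).
have l2 := dist_adj_r cG v (v := z2) (w := y).
rewrite adj_sym in l1; rewrite adj_sym in l2.
have {l1} := l1 yz1; have {l2} := l2 yz2.
case: (ltnP (dist G v z1) (dist G v y)) => c1.
  case: (leqP (dist G v z2) (dist G v y)) => c2; last by lia.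
  by move: z12; rewrite (closer_unique cG (br yz1) yz1 yz2 c1 c2) eqxx.
case: (ltnP (dist G v z2) (dist G v y)) => c2; last by lia.
case: (leqP (dist G v z1) (dist G v y)) => c3; last by lia.
by move: z12; rewrite (closer_unique cG (br yz2) yz2 yz1 c2 c3) eqxx.
Qed.

(** Pairs on the same side of the cut get no closer. Across the cut, the new distances are at least
    [d(u,h) + 1 + d(z,v)] for [z = z1, z2], and convexity bounds their sum. *)
Lemma two_moves_dist u v : (dist G u v).*2 <=
  dist (move_edge G y h z1) u v + dist (move_edge G y h z2) u v.
Proof.
have brh := br yh.
have c1 := move_edge_connected cG yh yz1 z1h.
have c2 := move_edge_connected cG yh yz2 z2h.
have cross a b : side G y h a -> ~~ side G y h b -> (dist G a b).*2 <=
    dist (move_edge G y h z1) a b + dist (move_edge G y h z2) a b.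
  move=> sa sb; rewrite (bridge_dist cG brh yh sa sb).
  have := move_edge_dist_cross cG brh yh yz1 z1h sa sb.
  have := move_edge_dist_cross cG brh yh yz2 z2h sa sb.
  have := two_moves_convex b; lia.
case: (boolP (side G y h u)) => su; case: (boolP (side G y h v)) => sv.
- by rewrite -addnn leq_add // move_edge_dist_inner // su sv.
- exact: cross.
- by rewrite (dist_sym cG) (dist_sym c1) (dist_sym c2); apply: cross.
- by rewrite -addnn leq_add // move_edge_dist_inner // (negbTE su) (negbTE sv).
Qed.

(** Either move takes [h] and [y] from distance 1 to at least 2. *)
Lemma two_moves_dist_lt : (dist G h y).*2 <
  dist (move_edge G y h z1) h y + dist (move_edge G y h z2) h y.
Proof.
have brh := br yh.
have sh : side G y h h by rewrite /side connect0.
have ny : ~~ side G y h y by rewrite /side connectC.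
have := move_edge_dist_cross cG brh yh yz1 z1h sh ny.
have := move_edge_dist_cross cG brh yh yz2 z2h sh ny.
rewrite (dist_sym cG z1) (dist_sym cG z2) (dist_sym cG h y).
by rewrite (dist_adj cG yh) (dist_adj cG yz1) (dist_adj cG yz2) distxx; lia.
Qed.

End TwoMoves.
End EdgeOperations.

(** * Trees layered by distance from a root *)

Section TreeLayers.
Set Implicit Arguments.
Unset Strict Implicit.
Variables (n : nat) (G : sgraph n).
Hypotheses (cG : connected_graph G) (br : forall a b, G a b -> bridge G a b).

Lemma tree_adj_dist u s t : G s t ->
  dist G u t = (dist G u s).+1 \/ dist G u s = (dist G u t).+1.
Proof.
move=> st; have ts : G t s by rewrite adj_sym.
have := bridge_dist_neq u cG (br st) st.
have := dist_adj_r cG u st; have := dist_adj_r cG u ts; lia.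
Qed.

Lemma parent_unique u s p p' : G s p -> G s p' ->
  dist G u p <= dist G u s -> dist G u p' <= dist G u s -> p = p'.
Proof.
move=> sp sp' c c'; apply: (closer_unique (v := u) cG (br sp') sp') => //.
by have := bridge_dist_neq u cG (br sp') sp'; lia.
Qed.

Lemma farthest_pendant y v : v != y ->
  (forall u, dist G y u <= dist G y v) -> v \in pendants G.
Proof.
rewrite eq_sym => yv far; have [p pv e] := closer_neighbour cG yv.
apply/pendantP; exists p; first by rewrite adj_sym.
by move=> w vw; apply: (parent_unique (u := y) (s := v)) => //; rewrite 1?adj_sym // e.
Qed.

Lemma pendant_childless e b t : b \in pendants G -> b != e ->
  G b t -> dist G e b = (dist G e t).+1.
Proof.
move=> /pendantP[q _ bN] be bt.
rewrite eq_sym in be; have [p pb ->] := closer_neighbour cG be.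
by rewrite (bN t bt) (bN p) 1?adj_sym.
Qed.

(** Besides its parent, [p] has room for one child. The root has no parent, so there pendancy is
    asked for instead. *)
Lemma child_unique e p t t' : degree G p <= 2 -> p != e \/ p \in pendants G ->
  G p t -> G p t' -> dist G e p < dist G e t -> dist G e p < dist G e t' -> t = t'.
Proof.
move=> dp pe pt pt' lt lt'; case: pe => [pe|/pendantP[q _ pN]]; last first.
  by rewrite (pN _ pt) (pN _ pt').
rewrite eq_sym in pe; have [q qp eq] := closer_neighbour cG pe.
apply/eqP; apply: contraTT dp => ne; rewrite -ltnNge.
apply/card_gt2P; exists t, t', q; rewrite !inE [G p q]adj_sym; split=> //.
split=> //; first by apply: contraTneq lt' => ->; lia.
by apply: contraTneq lt => <-; lia.
Qed.

(** Good vertices of one layer have good parents, which coincide by induction, and a vertex has at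
    most one good child. The predicate makes it possible to leave out a leaf that shares its
    layer. *)
Lemma layer_unique e (good : pred 'I_n) :
  (forall s t, G s t -> dist G e s < dist G e t -> good t -> good s) ->
  (forall p t t', G p t -> G p t' -> dist G e p < dist G e t ->
     dist G e p < dist G e t' -> good t -> good t' -> t = t') ->
  forall u v, good u -> good v -> dist G e u = dist G e v -> u = v.
Proof.
move=> up uniq u v; move: {2}(dist G e u) (erefl (dist G e u)) => k.
elim: k u v => [|k IH] u v eu gu gv euv.
  move: (eu) (eu); rewrite {2}euv => /eqP + /eqP.
  by rewrite !(dist_eq0 cG) => /eqP<- /eqP<-.
have [p pu ep] : exists2 p, G p u & dist G e u = (dist G e p).+1.
  by apply: closer_neighbour; rewrite -?(dist_eq0 cG) ?eu.
have [q qv eq] : exists2 q, G q v & dist G e v = (dist G e q).+1.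
  by apply: closer_neighbour; rewrite -?(dist_eq0 cG) -?euv ?eu.
have gp : good p by apply: up pu _ gu; rewrite ep.
have gq : good q by apply: up qv _ gv; rewrite eq.
have epq : p = q by apply: IH => //; lia.
by apply: (uniq p) => //; [rewrite epq | rewrite ep | rewrite eq epq].
Qed.

(** Otherwise each layer around a pendant [a] is a single vertex, and of two further pendant
    vertices the nearer one would have a child. *)
Lemma branching_exists : 2 < #|pendants G| -> exists y, 2 < degree G y.
Proof.
move=> /card_gt2P[a [b [c [[pa pb pc] [ab bc ca]]]]].
apply/existsP; apply: contraT => /existsPn nb.
have dle p : degree G p <= 2 by rewrite leqNgt nb.
have inj u v : dist G a u = dist G a v -> u = v.
  apply: (@layer_unique a predT) => // p t t' pt pt' lt lt' _ _.
  by apply: (child_unique (dle p) _ pt pt' lt lt'); case: (eqVneq p a) => [->|]; auto.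
have nlt u v : u \in pendants G -> u != a -> ~ dist G a u < dist G a v.
  move=> pu ua /(dist_intermediate cG)[t et].
  have [p pt ep] : exists2 p, G p t & dist G a t = (dist G a p).+1.
    by apply: closer_neighbour; rewrite -?(dist_eq0 cG) ?et.
  have eup : u = p by apply: inj; lia.
  by have := @pendant_childless a u t pu ua; rewrite {1}eup => /(_ pt); lia.
have ba : b != a by rewrite eq_sym.
case: (ltngtP (dist G a b) (dist G a c)) => [|| /inj ebc].
- by move/(nlt b c pb ba).
- by move/(nlt c b pc ca).
- by move: bc; rewrite ebc eqxx.
Qed.

End TreeLayers.

(** * Coordinates on the target tree *)

Section Tree12Code.
Set Implicit Arguments.
Unset Strict Implicit.

(* The vertex of tree12 n at distance i from the pendant vertex n - 3, other than
   n - 1. *)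
Definition tree12_code n i :=
  if i == 0 then n - 3 else if i == n - 2 then n - 2 else i.-1.

Definition tree12_edge n i j := (i != j) && (tree12_arc n i j || tree12_arc n j i).

Lemma tree12_edgeC n i j : tree12_edge n i j = tree12_edge n j i.
Proof. by rewrite /tree12_edge eq_sym [X in _ && X]orbC. Qed.

(** Without [n - 1] the tree is a path from [n - 3] to [n - 2], which [tree12_code] lists in
    order. *)
Lemma tree12_code_edge n i j : 5 <= n -> i <= n - 2 -> j <= n - 2 ->
  tree12_edge n (tree12_code n i) (tree12_code n j) = (j == i.+1) || (i == j.+1).
Proof.
case: n => [|[|[|[|[|m]]]]] // _.
wlog ij : i j / i <= j => [H li lj|li lj].
  case/orP: (leq_total i j) => ij; first exact: H.
  by rewrite tree12_edgeC H // orbC.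
rewrite /tree12_edge /tree12_code /tree12_arc !subSS !subn0 in li lj *.
case: i ij li => [|i] ij li; case: j ij lj => [|j] ij lj //=.
- by rewrite eqxx.
- rewrite !eqSS; case: (eqVneq j m.+2) => [->|jm]; lia.
- rewrite !eqSS; case: (eqVneq i m.+2) => [ei|im]; case: (eqVneq j m.+2) => [ej|jm].
  + lia.
  + lia.
  + lia.
  + lia.
Qed.

(** The neighbour of [n - 1] is [n - 4], at position [n - 3] on the path. *)
Lemma tree12_twin_edge n j : 5 <= n -> j <= n - 2 ->
  tree12_edge n (n - 1) (tree12_code n j) = (j == n - 3).
Proof.
rewrite /tree12_edge; case: n => [|[|[|[|[|m]]]]] // _.
rewrite /tree12_code /tree12_arc !subSS !subn0 => lj.
case: j lj => [|j] lj; rewrite ?eqSS /=; first by lia.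
by case: (eqVneq j m.+2) => [ej|jm] /=; lia.
Qed.

Lemma tree12_code_inj n i j : 5 <= n -> i <= n - 2 -> j <= n - 2 ->
  tree12_code n i = tree12_code n j -> i = j.
Proof. by rewrite /tree12_code; do 4?case: ifP; lia. Qed.

Lemma tree12_code_lt n i : 5 <= n -> i <= n - 2 -> tree12_code n i < n - 1.
Proof. by rewrite /tree12_code; do 2?case: ifP; lia. Qed.

End Tree12Code.

(** * The shape of a tree without improving moves *)

Section ExtremalTree.
Set Implicit Arguments.
Unset Strict Implicit.
Variables (n : nat) (G : sgraph n).
Hypotheses (cG : connected_graph G) (br : forall a b, G a b -> bridge G a b).
Hypothesis pG : 2 < #|pendants G|.
Hypothesis no_move : forall y h z1 z2, G y h -> G y z1 -> G y z2 ->
  z1 != h -> z2 != h -> z1 != z2 -> y \notin pendants G ->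
  ~ (2 < #|pendants G :\ z1| /\ 2 < #|pendants G :\ z2|).

Local Notation N y := [set v | G y v].

Lemma branching_notpendant y : 2 < degree G y -> y \notin pendants G.
Proof. by rewrite inE; lia. Qed.

(** With four pendant vertices, three remain whichever [z] is discarded, so both moves at a
    branching vertex would be allowed. *)
Lemma extremal_pendants : #|pendants G| = 3.
Proof.
have [y dy] := branching_exists cG pG.
have /card_gt2P[h [z1 [z2 [[]]]]] := dy; rewrite !inE => yh yz1 yz2 [h1 n12 n2].
apply/eqP; apply: contraT => n3.
rewrite eq_sym in h1.
case: (no_move yh yz1 yz2 h1 n2 n12 (branching_notpendant dy)).
have big z : 2 < #|pendants G :\ z|.
  by move: pG n3; rewrite (cardsD1 z); case: (z \in _); lia.
by split.
Qed.

(** A third neighbour serves as the branch [h]; moving it to a non-pendant vertex costs no pendant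
    vertex, so both moves would be allowed. *)
Lemma nonpendant_unique y z1 z2 : 2 < degree G y -> G y z1 -> G y z2 ->
  z1 \notin pendants G -> z2 \notin pendants G -> z1 = z2.
Proof.
move=> dy yz1 yz2 p1 p2; apply/eqP; apply: contraT => n12.
have : 0 < #|N y :\ z1 :\ z2|.
  have := cardsD1 z1 (N y); have := cardsD1 z2 (N y :\ z1).
  by rewrite -/(degree G y); lia.
case/card_gt0P=> h; rewrite !inE => /and3P[n2 n1 yh].
case: (no_move yh yz1 yz2 _ _ n12 (branching_notpendant dy)); rewrite 1?eq_sym //.
have big z : z \notin pendants G -> 2 < #|pendants G :\ z|.
  by move=> pz; move: pG; rewrite (cardsD1 z) (negbTE pz).
by split; apply: big.
Qed.

Lemma pendant_neighbours y : 2 < degree G y ->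
  exists a b, [/\ a != b, G y a, G y b, a \in pendants G & b \in pendants G].
Proof.
move=> dy; have le1 : #|N y :\: pendants G| <= 1.
  apply/card_le1_eqP => u v; rewrite !inE => /andP[pu yu] /andP[pv yv].
  by apply: (nonpendant_unique dy); rewrite ?inE.
have : 1 < #|N y :&: pendants G|.
  move: dy; rewrite /degree -(cardsID (pendants G)) => dy.
  by rewrite -(leq_add2r 1) (leq_trans dy) // leq_add2l.
case/card_gt1P=> a [b [+ + ab]]; rewrite !inE => /andP[ya pa] /andP[yb pb].
by exists a, b; rewrite !inE.
Qed.

Lemma pendant_neighbour_eq a y w : a \in pendants G -> G y a -> G a w -> w = y.
Proof.
case/pendantP=> q _ aN; rewrite adj_sym => ay aw.
by rewrite (aN _ aw) (aN _ ay).
Qed.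

(** With one of the pendant neighbours [a], [b] of the branching vertex [y] set aside, the rest is a
    path from a far pendant vertex [e] to [a], and the distance from [e] is the coordinate on it. *)
Lemma extremal_isomorphic : 5 <= n -> isomorphic G (tree12 n).
Proof.
move=> n5; have [y dy] := branching_exists cG pG.
have [a [b [ab ya yb pa pb]]] := pendant_neighbours dy.
have p3 := extremal_pendants.
have [e _ far] := arg_maxnP (dist G y) (isT : predT y).
have {}far u : dist G y u <= dist G y e by apply: far.
(* Otherwise all [n - 1 >= 4] vertices other than [y] would be farthest from [y], hence pendant. *)
have ne : ~~ G y e.
  apply/negP=> ye; have e1 := dist_adj cG ye.
  have : #|[set~ y]| <= #|pendants G|.
    apply/subset_leq_card/subsetP=> v /[!in_setC1] vy.
    apply: (farthest_pendant cG br vy) => u; apply: leq_trans (far u) _.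
    by rewrite e1 lt0n (dist_eq0 cG) eq_sym.
  by rewrite p3 cardsC1 card_ord; lia.
have ey : e != y.
  apply/negP=> /eqP ey; move: (far a); rewrite ey distxx (dist_adj cG ya); lia.
have pe : e \in pendants G by apply: (farthest_pendant cG br ey).
have ae : a != e by apply: contraNneq ne => <-.
have be : b != e by apply: contraNneq ne => <-.
have epend : pendants G = a |: [set b; e].
  apply/esym/eqP; rewrite eqEcard p3 cardsU1 cards2 !inE.
  rewrite ?ab ?be (negbTE ae) (negbTE ab) /= andbT.
  by apply/subsetP=> u; rewrite in_setU1 => /orP[/eqP->//|]; rewrite in_set2 => /orP[]/eqP->.
(* Since [a] and [b] hang at [y], another branching vertex could only have [e] as pendant
   neighbour. *)
have deg2 p : p != y -> degree G p <= 2.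
  move=> py; rewrite leqNgt; apply/negP=> dp.
  have [a' [b' [ab' pa' pb' Pa Pb]]] := pendant_neighbours dp.
  have other c : c \in pendants G -> G p c -> c = e.
    rewrite epend in_setU1 in_set2 => /or3P[/eqP->|/eqP->|/eqP //] pc.
      by move: py; rewrite (pendant_neighbour_eq pa ya _ (w := p)) ?eqxx // adj_sym.
    by move: py; rewrite (pendant_neighbour_eq pb yb _ (w := p)) ?eqxx // adj_sym.
  by move: ab'; rewrite (other a') // (other b') // eqxx.
set d := dist G e.
have da : d a = (d y).+1 by apply: (pendant_childless cG pa ae); rewrite adj_sym.
have db : d b = (d y).+1 by apply: (pendant_childless cG pb be); rewrite adj_sym.
have inj u v : u != b -> v != b -> d u = d v -> u = v.
  apply: (@layer_unique _ _ cG e (fun w => w != b))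
    => [s t st lt _|p t t' pt pt' lt lt' tb tb'].
    apply: contraTneq lt => es; rewrite es in st *.
    by rewrite (pendant_childless cG pb be st) -leqNgt leqnSn.
  case: (eqVneq p y) => [py|py]; last first.
    apply: (child_unique cG (deg2 _ py) _ pt pt' lt lt').
    by case: (eqVneq p e) => [->|]; auto.
  subst p; have [q qy eq] : exists2 q, G q y & dist G e y = (dist G e q).+1.
    exact: closer_neighbour.
  (* The parent [q] of [y] is its only non-pendant neighbour, so a child is pendant, and it is not
     [e], which is not adjacent to [y]. *)
  have child c : G y c -> dist G e y < dist G e c -> c != b -> c = a.
    move=> yc lc cb; apply/eqP; apply: contraTT lc => ca.
    have [pc|pc] := boolP (c \in pendants G).
      move: pc; rewrite epend in_setU1 in_set2 (negbTE ca) (negbTE cb) /=.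
      by move/eqP => ec; move: ne; rewrite -ec yc.
    rewrite -leqNgt (nonpendant_unique dy yc (z2 := q)) // ?eq 1?adj_sym //.
    apply/negP=> pq; move: eq.
    have [eqe|qe] := eqVneq q e; first by move: ne; rewrite -eqe adj_sym qy.
    by move: (pendant_childless cG pq qe qy); clear; lia.
  by rewrite (child t) // (child t').
(* A vertex in the layer after [a] would have its parent in the layer of [a], which consists of the
   childless [a] and [b]. *)
have dle u : d u <= d a.
  rewrite leqNgt; apply/negP=> lt.
  have [t et] := dist_intermediate cG lt.
  have [p pt ep] : exists2 p, G p t & dist G e t = (dist G e p).+1.
    by apply: closer_neighbour; rewrite -?(dist_eq0 cG) ?et.
  have epa : d p = d a by apply: succn_inj; rewrite -et -ep.
  have [pb'|pb'] := eqVneq p b.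
    rewrite pb' in pt ep; move: (pendant_childless cG pb be pt) ep; clear; lia.
  have pa' := inj _ _ pb' ab epa; rewrite pa' in pt ep.
  by move: (pendant_childless cG pa ae pt) ep; clear; lia.
(* [d] maps the [n - 1] vertices other than [b] bijectively onto [0, ..., d a]; the layer of [b] is
   also hit by [a]. *)
have dan : d a = n - 2.
  pose f u : 'I_(d a).+1 := inord (d u).
  have fE u : f u = d u :> nat by rewrite inordK // ltnS.
  have : #|f @: [set~ b]| = n.-1.
    rewrite card_in_imset ?cardsC1 ?card_ord // => u v /[!in_setC1] ub vb.
    by move=> /(congr1 val) /=; rewrite !fE; apply: inj.
  have -> : f @: [set~ b] = setT.
    apply/setP=> k; rewrite in_setT; apply/imsetP.
    have [t et] := dist_intermediate cG (ltnSE (ltn_ord k)).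
    have [tb|tb] := eqVneq t b; last first.
      by exists t; [rewrite !inE tb | apply/val_inj; rewrite /= fE].
    exists a; first by rewrite !inE ab.
    by apply/val_inj; rewrite /= fE -et tb -/d db da.
  by rewrite cardsT card_ord; move: n5; clear; lia.
have bN w : G b w -> w = y by apply: pendant_neighbour_eq pb yb.
have yb' : y != b by apply: contraTneq yb => ->; rewrite adj_irr.
have Gb v : G b v = (v != b) && (d v == n - 3).
  apply/idP/andP=> [bv|[vb /eqP dv]].
    by rewrite (bN v bv) yb'; split=> //; move: da dan n5; clear; lia.
  by rewrite (inj v y) // ?dv; [rewrite adj_sym | move: da dan n5; clear; lia].
have Gd u v : u != b -> v != b -> G u v = (d v == (d u).+1) || (d u == (d v).+1).
  have child s t : s != b -> t != b -> d t = (d s).+1 -> G s t.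
    move=> sb tb dt.
    have [p pt ep] : exists2 p, G p t & dist G e t = (dist G e p).+1.
      by apply: closer_neighbour; rewrite -?(dist_eq0 cG) -/(d t) ?dt.
    have pb' : p != b.
      apply: contraTneq isT => epb; rewrite epb in pt ep.
      by move: (pendant_childless cG pb be pt) ep; clear; lia.
    by rewrite (inj s p) //; apply: succn_inj; rewrite -dt -ep.
  move=> ub vb; apply/idP/orP => [uv|[]/eqP dd].
  - by case: (tree_adj_dist cG br e uv) => /eqP; rewrite -/d; [left|right].
  - exact: child.
  - by rewrite adj_sym; apply: child.
pose g u := if u == b then n - 1 else tree12_code n (d u).
have {}dle u : d u <= n - 2 by rewrite -dan.
have code_lt u : tree12_code n (d u) < n - 1 by exact: tree12_code_lt.
have g_lt u : g u < n.
  by rewrite /g; case: ifP; move: (code_lt u) n5; clear; lia.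
have g_inj : injective (fun u => Ordinal (g_lt u)).
  move=> u v /(congr1 val) /=; rewrite /g.
  case: (eqVneq u b) => [->|ub]; case: (eqVneq v b) => [->|vb] //.
  - by move=> E; have := code_lt v; rewrite -E ltnn.
  - by move=> E; have := code_lt u; rewrite E ltnn.
  - by move/(tree12_code_inj n5 (dle u) (dle v)); apply: inj.
exists (fun u => Ordinal (g_lt u)); first exact: injF_bij.
move=> u v.
rewrite -[LHS]/((Ordinal (g_lt u) != Ordinal (g_lt v)) &&
  (tree12_arc n (g u) (g v) || tree12_arc n (g v) (g u))).
rewrite -val_eqE -[LHS]/(tree12_edge n (g u) (g v)) /g.
case: (eqVneq u b) => [->|ub]; case: (eqVneq v b) => [->|vb].
- by rewrite adj_irr /tree12_edge eqxx.
- by rewrite Gb vb tree12_twin_edge.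
- by rewrite adj_sym Gb ub tree12_edgeC tree12_twin_edge.
- by rewrite Gd // tree12_code_edge.
Qed.

End ExtremalTree.

(** * Quadratic forms, Rayleigh quotients and a positive maximiser *)

Section Rayleigh.
Set Implicit Arguments.
Unset Strict Implicit.
Local Open Scope ring_scope.
Variables (R : realType) (n : nat).
Implicit Types (A M : 'M[R]_n) (x y z : 'rV[R]_n).

Definition bilin A y z : R := (y *m A *m z^T) 0 0.

Definition sqnorm z : R := \sum_i z 0 i ^+ 2.

Lemma bilinE A y z : bilin A y z = \sum_i \sum_j y 0 i * A i j * z 0 j.
Proof.
rewrite /bilin mxE exchange_big /=; apply: eq_bigr => j _.
by rewrite !mxE mulr_suml; apply: eq_bigr => i _; rewrite ?mxE.
Qed.

Lemma bilin1 z : bilin 1%:M z z = sqnorm z.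
Proof. by rewrite /bilin mulmx1 mxE; apply: eq_bigr => i _; rewrite mxE expr2. Qed.

Lemma sqnormE z : sqnorm z = (z *m z^T) 0 0.
Proof. by rewrite -bilin1 /bilin mulmx1. Qed.

Lemma sqnorm_ge0 z : 0 <= sqnorm z.
Proof. by apply: sumr_ge0 => i _; apply: sqr_ge0. Qed.

Lemma sqnorm_eq0 z : (sqnorm z == 0) = (z == 0).
Proof.
rewrite /sqnorm psumr_eq0; last by move=> i _; apply: sqr_ge0.
apply/allP/eqP => [z0|-> i _]; last by rewrite /= mxE expr0n /= eqxx.
by apply/rowP=> i; rewrite mxE; apply/eqP; rewrite -sqrf_eq0; apply: z0; apply: mem_index_enum.
Qed.

Lemma sqnorm_gt0 z : (0 < sqnorm z) = (z != 0).
Proof. by rewrite lt0r sqnorm_eq0 sqnorm_ge0 andbT. Qed.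

Lemma bilin_scalarB A l z : bilin (l%:M - A) z z = l * sqnorm z - bilin A z z.
Proof.
rewrite sqnormE /bilin mulmxBr mulmxBl mul_mx_scalar -scalemxAl.
by rewrite mxE [X in X + _]mxE [X in _ + X]mxE.
Qed.

Lemma bilin_comb A s t y z : A^T = A ->
  bilin A (s *: y + t *: z) (s *: y + t *: z) =
  s ^+ 2 * bilin A y y + s * t * bilin A y z *+ 2 + t ^+ 2 * bilin A z z.
Proof.
move=> sA; have fC : bilin A z y = bilin A y z.
  rewrite /bilin; set B := z *m A *m y^T.
  have -> : B 0 0 = B^T 0 0 by rewrite [RHS]mxE.
  by rewrite /B !trmx_mul trmxK sA mulmxA.
have lin w w' c c' v : bilin A (c *: w + c' *: w') v = c * bilin A w v + c' * bilin A w' v.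
  by rewrite /bilin !mulmxDl -!scalemxAl !mxE.
have linr w w' c c' v : bilin A v (c *: w + c' *: w') = c * bilin A v w + c' * bilin A v w'.
  by rewrite /bilin linearD !linearZ /= mulmxDr -!scalemxAr !mxE.
by rewrite lin !linr fC; ring.
Qed.

Lemma psd_cauchy_schwarz M y z : M^T = M -> (forall w, 0 <= bilin M w w) ->
  bilin M y z ^+ 2 <= bilin M y y * bilin M z z.
Proof.
move=> sM psd; set a := bilin M y y; set b := bilin M y z; set c := bilin M z z.
have H s t : 0 <= s ^+ 2 * a + s * t * b *+ 2 + t ^+ 2 * c.
  by rewrite -bilin_comb.
have a0 : 0 <= a by apply: psd.
have c0 : 0 <= c by apply: psd.
move: c0; rewrite le_eqVlt => /orP[/eqP c0|c0].
  rewrite -c0 mulr0; case: (eqVneq b 0) => [->|b0]; first by rewrite expr0n.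
  (* For [c = 0] the form is affine in [t]; this [t] gives it the value -1. *)
  have := H 1 (- (a + 1) / (b *+ 2)); rewrite -c0 mulr0 addr0.
  have -> : 1 ^+ 2 * a + 1 * (- (a + 1) / (b *+ 2)) * b *+ 2 = - 1.
    by field; rewrite b0.
  by rewrite ler0N1.
(* This is the minimising direction, where the form is [c] times the Gram determinant. *)
have := H c (- b).
have -> : c ^+ 2 * a + c * - b * b *+ 2 + (- b) ^+ 2 * c = c * (a * c - b ^+ 2) by ring.
by rewrite pmulr_rge0 // subr_ge0.
Qed.

(** Cauchy-Schwarz for [x] and [x *m M] bounds the squared [sqnorm] of [x *m M] by a multiple of
    [bilin M x x]. *)
Lemma psd_kernel M x : M^T = M -> (forall w, 0 <= bilin M w w) ->
  bilin M x x = 0 -> x *m M = 0.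
Proof.
move=> sM psd x0; apply/eqP; rewrite -sqnorm_eq0 -sqrf_eq0 eq_le sqr_ge0 andbT.
have := psd_cauchy_schwarz x (x *m M) sM psd.
by rewrite x0 mul0r /bilin -sqnormE.
Qed.

Lemma bilin_le_sqnorm A : exists2 c, 0 < c & forall z, bilin A z z <= c * sqnorm z.
Proof.
exists (1 + \sum_i \sum_j `|A i j|).
  by rewrite ltr_pwDl // sumr_ge0 // => i _; rewrite sumr_ge0.
move=> z; rewrite mulrDl mul1r ler_wpDl ?sqnorm_ge0 // bilinE mulr_suml.
apply: ler_sum => i _; rewrite mulr_suml; apply: ler_sum => j _.
have le k : z 0 k ^+ 2 <= sqnorm z.
  by rewrite /sqnorm (bigD1 k) //= lerDl sumr_ge0 // => l _; apply: sqr_ge0.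
apply: le_trans (ler_norm _) _; rewrite !normrM -mulrA mulrCA.
apply: ler_wpM2l => //; have := le i; have := le j.
rewrite -[z 0 i ^+ 2]real_normK ?num_real // -[z 0 j ^+ 2]real_normK ?num_real //.
set a := `|z 0 i|; set b := `|z 0 j| => lb la.
have := sqr_ge0 (a - b); nra.
Qed.

(* Let l be the supremum of the Rayleigh quotients, so that M = l - A is positive
   semidefinite. If M were invertible, Cauchy-Schwarz at (z M^-1, z) would give
   z M z^T >= |z|^2 / d for some d > 0, and l - 1/d would still be an upper
   bound. *)
Lemma max_rayleigh A : (0 < n)%N -> A^T = A ->
  exists2 l, eigenvalue A l & forall z, bilin A z z <= l * sqnorm z.
Proof.
move=> n0 sA; have [c c0 cA] := bilin_le_sqnorm A.
pose S := [set a : R | exists2 z, z != 0 & a = bilin A z z / sqnorm z]%classic.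
have sq0 z : z != 0 -> 0 < sqnorm z.
  by rewrite sqnorm_gt0.
have S0 : (S !=set0)%classic.
  have z0 : (const_mx 1 : 'rV[R]_n) != 0.
    apply/eqP => /rowP /(_ (Ordinal n0)); rewrite !mxE => /eqP.
    by rewrite oner_eq0.
  by exists (bilin A (const_mx 1) (const_mx 1) / sqnorm (const_mx 1)); exists (const_mx 1).
have ubS : has_ubound S.
  by exists c => _ [z z0 ->]; rewrite ler_pdivrMr ?sq0.
pose l := sup S.
have le z : bilin A z z <= l * sqnorm z.
  case: (eqVneq z 0) => [->|z0].
    have /eqP -> : sqnorm 0 == 0 by rewrite sqnorm_eq0.
    by rewrite /bilin !mul0mx mxE mulr0.
  rewrite -ler_pdivrMr ?sq0 //; apply: (ub_le_sup ubS).
  by exists z.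
exists l => //.
have -> : eigenvalue A l = (A - l%:M \notin unitmx).
  by rewrite /eigenvalue /eigenspace kermx_eq0 row_free_unit.
apply/negP=> uM; pose M := l%:M - A.
have uM' : M \in unitmx by rewrite /M -opprB -scaleN1r unitmxZ ?unitrN1.
have sM : M^T = M by rewrite /M linearB /= tr_scalar_mx sA.
have bilinM z : bilin M z z = l * sqnorm z - bilin A z z by exact: bilin_scalarB.
have psd z : 0 <= bilin M z z by rewrite bilinM subr_ge0.
have [d d0 dM] := bilin_le_sqnorm (invmx M)^T.
have gap z : z != 0 -> sqnorm z <= d * bilin M z z.
  move=> z0; have := psd_cauchy_schwarz (z *m invmx M) z sM psd.
  have -> : bilin M (z *m invmx M) z = sqnorm z by rewrite /bilin mulmxKV // -sqnormE.
  have -> : bilin M (z *m invmx M) (z *m invmx M) = bilin (invmx M)^T z z.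
    by rewrite /bilin mulmxKV // trmx_mul mulmxA.
  move=> cs; rewrite -(ler_pM2l (sq0 z z0)) -expr2; apply: le_trans cs _.
  by rewrite mulrA [sqnorm z * d]mulrC ler_wpM2r.
have : l <= l - d^-1.
  apply: ge_sup => // _ [z z0 ->]; rewrite ler_pdivrMr ?sq0 // mulrBl.
  have := gap z z0; rewrite bilinM -ler_pdivrMl // => g.
  by rewrite lerBrDl -lerBrDr.
by rewrite lerDl oppr_ge0 leNgt invr_gt0 d0.
Qed.

Lemma eigenvalue_le A l a : (forall z, bilin A z z <= l * sqnorm z) ->
  eigenvalue A a -> a <= l.
Proof.
move=> le /eigenvalueP[v va v0].
move: v0; rewrite -sqnorm_gt0 => s0; rewrite -(ler_pM2r s0); apply: le_trans (le v).
by rewrite /bilin va -scalemxAl mxE -sqnormE.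
Qed.

(** The maximal Rayleigh quotient is an eigenvalue and bounds all others, so the supremum defining
    [rhoQ] is attained there. *)
Lemma sup_eigenvalue A : (0 < n)%N -> A^T = A ->
  let r := sup [set a : R | eigenvalue A a]%classic in
  eigenvalue A r /\ forall z, bilin A z z <= r * sqnorm z.
Proof.
move=> n0 sA r; have [l el le] := max_rayleigh n0 sA.
suff -> : r = l by [].
apply/eqP; rewrite eq_le; apply/andP; split.
  by apply: ge_sup; [exists l | move=> a; apply: eigenvalue_le].
by apply: ub_le_sup => //; exists l => a; apply: eigenvalue_le.
Qed.

(** Taking absolute values in an eigenvector does not lower the quotient, so [x] lies in the kernel
    of [r - A]. If [x] vanished at [i], column [i] of [x *m A = r *: x] would force [x = 0]. *)
Lemma perron_vector A r : A^T = A ->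
  (forall i j, 0 <= A i j) -> (forall i j, i != j -> 0 < A i j) ->
  eigenvalue A r -> (forall z, bilin A z z <= r * sqnorm z) ->
  exists2 x : 'rV[R]_n, (forall i, 0 < x 0 i) & bilin A x x = r * sqnorm x.
Proof.
move=> sA A0 Apos /eigenvalueP[v va v0] le.
pose x : 'rV[R]_n := \row_i `|v 0 i|.
have x0 i : 0 <= x 0 i by rewrite mxE.
have sx : sqnorm x = sqnorm v.
  by apply: eq_bigr => i _; rewrite mxE real_normK ?num_real.
have fx : bilin A x x = r * sqnorm x.
  apply/eqP; rewrite eq_le le /= sx.
  have <- : bilin A v v = r * sqnorm v by rewrite /bilin va -scalemxAl mxE -sqnormE.
  rewrite !bilinE; apply: ler_sum => i _; apply: ler_sum => j _.
  apply: le_trans (ler_norm _) _.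
  by rewrite !normrM !mxE (ger0_norm (A0 i j)).
exists x => // i; rewrite lt_neqAle x0 andbT eq_sym; apply/eqP=> xi.
pose M := r%:M - A.
have bilinM z : bilin M z z = r * sqnorm z - bilin A z z by exact: bilin_scalarB.
have : x *m M = 0.
  apply: psd_kernel; first by rewrite /M linearB /= tr_scalar_mx sA.
    by move=> w; rewrite bilinM subr_ge0.
  by rewrite bilinM fx subrr.
rewrite /M mulmxBr mul_mx_scalar => /eqP; rewrite subr_eq0 => /eqP /rowP /(_ i).
rewrite mxE xi mulr0 mxE => /esym/eqP; rewrite psumr_eq0; last by move=> j _; rewrite mulr_ge0.
move/allP=> z0; move/eqP: v0; apply; apply/rowP=> j; rewrite mxE.
apply/eqP; rewrite -normr_eq0; case: (eqVneq j i) => [->|ji].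
  by apply/eqP; rewrite -xi mxE.
have := z0 j (mem_index_enum _); rewrite /= mulf_eq0 mxE => /orP[//|].
by rewrite gt_eqF ?Apos.
Qed.

End Rayleigh.

(** * The energy and its maximisers *)

Section Energy.
Set Implicit Arguments.
Unset Strict Implicit.
Local Open Scope ring_scope.
Variables (R : realType) (n : nat).
Implicit Types (G : sgraph n) (x : 'rV[R]_n).

Definition energy x G : R :=
  \sum_u \sum_v (dist G u v)%:R * (x 0 u + x 0 v) ^+ 2.

Lemma dsl_mxE G i j :
  dsl_mx R G i j = (transmission G i)%:R *+ (i == j) + (dist G i j)%:R.
Proof. by rewrite !mxE; case: eqP => [->|]. Qed.

Lemma dsl_mx_sym G : connected_graph G -> (dsl_mx R G)^T = dsl_mx R G.
Proof.
move=> cG; apply/matrixP=> i j; rewrite mxE !dsl_mxE (dist_sym cG) eq_sym.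
by case: eqP => [->|].
Qed.

(** In the expanded square, both square terms give the transmission part [S], by symmetry of the
    distance, and the mixed term gives twice [P]. *)
Lemma energy_bilin x G : connected_graph G -> energy x G = bilin (dsl_mx R G) x x *+ 2.
Proof.
move=> cG; pose S := \sum_u \sum_v (dist G u v)%:R * x 0 u ^+ 2.
pose P := \sum_u \sum_v x 0 u * (dist G u v)%:R * x 0 v.
have -> : bilin (dsl_mx R G) x x = S + P.
  rewrite bilinE -big_split /=; apply: eq_bigr => u _.
  under eq_bigr do rewrite dsl_mxE mulrDr mulrDl.
  rewrite big_split /=; congr (_ + _).
  rewrite (bigD1 u) //= eqxx big1 ?addr0 => [|v]; last first.
    by rewrite eq_sym => /negbTE->; rewrite mulr0n mulr0 mul0r.
  by rewrite mulr1n /transmission natr_sum mulrAC -expr2 mulr_sumr;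
     apply: eq_bigr => v _; rewrite mulrC.
have S' : \sum_u \sum_v (dist G u v)%:R * x 0 v ^+ 2 = S.
  rewrite exchange_big; apply: eq_bigr => u _; apply: eq_bigr => v _.
  by rewrite (dist_sym cG).
rewrite mulr2n addrACA -{2}S' /energy /S /P -!big_split /=; apply: eq_bigr => u _.
by rewrite -!big_split; apply: eq_bigr => v _ /=; ring.
Qed.

Lemma sum_dist_lt (a b : 'I_n -> 'I_n -> nat) (w : 'I_n -> 'I_n -> R) u0 v0 :
  (forall u v, 0 < w u v) -> (forall u v, a u v <= b u v)%N ->
  (a u0 v0 < b u0 v0)%N ->
  \sum_u \sum_v (a u v)%:R * w u v < \sum_u \sum_v (b u v)%:R * w u v.
Proof.
move=> w0 ab lt.
have le u v : (a u v)%:R * w u v <= (b u v)%:R * w u v.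
  by rewrite ler_wpM2r ?ler_nat // ltW.
rewrite (bigD1 u0) // [ltRHS](bigD1 u0) //=; apply: ltr_leD; last first.
  by apply: ler_sum => u _; apply: ler_sum.
rewrite (bigD1 v0) // [ltRHS](bigD1 v0) //=; apply: ltr_leD; last exact: ler_sum.
by rewrite ltr_pM2r ?ltr_nat.
Qed.

Definition energy_maximal x G := forall G', connected_graph G' ->
  (2 < #|pendants G'|)%N -> energy x G' <= energy x G.

Section Maximal.
Variables (x : 'rV[R]_n) (G : sgraph n).
Hypotheses (x0 : forall i, 0 < x 0 i) (cG : connected_graph G).
Hypotheses (pG : (2 < #|pendants G|)%N) (maxG : energy_maximal x G).

Let w0 u v : 0 < (x 0 u + x 0 v) ^+ 2.
Proof. by rewrite exprn_gt0 // addr_gt0. Qed.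

Lemma maximal_bridge a b : G a b -> bridge G a b.
Proof.
move=> ab; apply: contraT => /(nonbridge_del_connected cG) cD.
have pD := subset_leq_card (del_edge_pendants ab cD).
have /(_ cD (leq_trans pG pD)) := @maxG (del_edge G a b).
rewrite leNgt => /negP[].
apply: (sum_dist_lt w0 _ (del_edge_dist_lt ab cG cD)) => u v.
exact: del_edge_dist.
Qed.

Lemma maximal_no_move y h z1 z2 : G y h -> G y z1 -> G y z2 ->
  z1 != h -> z2 != h -> z1 != z2 -> y \notin pendants G ->
  ~ ((2 < #|pendants G :\ z1|) /\ (2 < #|pendants G :\ z2|))%N.
Proof.
move=> yh yz1 yz2 z1h z2h z12 py [p1 p2].
have better z : G y z -> z != h -> (2 < #|pendants G :\ z|)%N ->
    energy x (move_edge G y h z) <= energy x G.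
  move=> yz zh pz; apply: maxG; first exact: move_edge_connected.
  exact: leq_trans pz (subset_leq_card (move_edge_pendants yh zh py)).
have := lerD (better _ yz1 z1h p1) (better _ yz2 z2h p2).
rewrite leNgt => /negP[].
pose d := fun u v => (dist (move_edge G y h z1) u v + dist (move_edge G y h z2) u v)%N.
have -> : energy x G + energy x G =
    \sum_u \sum_v ((dist G u v).*2)%:R * (x 0 u + x 0 v) ^+ 2.
  rewrite -big_split; apply: eq_bigr => u _; rewrite -big_split.
  by apply: eq_bigr => v _; rewrite -addnn natrD mulrDl.
have -> : energy x (move_edge G y h z1) + energy x (move_edge G y h z2) =
    \sum_u \sum_v (d u v)%:R * (x 0 u + x 0 v) ^+ 2.
  rewrite -big_split; apply: eq_bigr => u _; rewrite -big_split.
  by apply: eq_bigr => v _; rewrite natrD mulrDl.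
apply: (@sum_dist_lt (fun u v => (dist G u v).*2) d _ h y w0) => [u v|].
  exact: (two_moves_dist cG maximal_bridge yh yz1 yz2 z1h z2h z12).
exact: (two_moves_dist_lt cG maximal_bridge yh yz1 yz2 z1h z2h).
Qed.

Lemma maximal_pendants : #|pendants G| = 3.
Proof. exact: (extremal_pendants cG pG maximal_no_move). Qed.

Lemma maximal_isomorphic : (5 <= n)%N -> isomorphic G (tree12 n).
Proof. exact: (extremal_isomorphic cG maximal_bridge pG maximal_no_move). Qed.

End Maximal.

Lemma sgraph_ext G G' : (forall u v, G u v = G' u v) -> G = G'.
Proof.
case: G G' => e es ei [e' es' ei'] /= ee.
have {}ee : e = e' by apply/funext => u; apply/funext => v.
by subst e'; congr SGraph; apply: Prop_irrelevance.
Qed.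

(* Finite functions encode graphs so that a maximiser of the energy can be picked
   in a finite type. *)
Section Code.
Variable f : {ffun 'I_n * 'I_n -> bool}.

Definition code_adj : rel 'I_n := fun i j => (i != j) && (f (i, j) || f (j, i)).

Lemma code_adj_sym : symmetric code_adj.
Proof. by move=> i j; rewrite /code_adj eq_sym orbC. Qed.

Lemma code_adj_irr : irreflexive code_adj.
Proof. by move=> i; rewrite /code_adj eqxx. Qed.

Definition sgraph_of := SGraph code_adj_sym code_adj_irr.
End Code.

Lemma sgraph_ofK G : sgraph_of [ffun p => G p.1 p.2] = G.
Proof.
apply: sgraph_ext => u v; rewrite /= /code_adj !ffunE /= [G v u]adj_sym orbb.
by apply: andb_idl; apply: adj_neq.
Qed.

Lemma energy_maximal_exists x G : connected_graph G -> (2 < #|pendants G|)%N ->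
  exists M, [/\ connected_graph M, (2 < #|pendants M|)%N & energy_maximal x M].
Proof.
pose P f := [forall u, forall v, connect (sgraph_of f) u v] &&
  (2 < #|pendants (sgraph_of f)|)%N.
have codeP G' : connected_graph G' -> (2 < #|pendants G'|)%N ->
    P [ffun p => G' p.1 p.2].
  by move=> cG' pG'; rewrite /P sgraph_ofK pG' andbT; apply/'forall_forallP.
move=> cG pG.
have [f /andP[/'forall_forallP cf pf] fmax] :=
  arg_maxP (fun f => energy x (sgraph_of f)) (codeP _ cG pG).
exists (sgraph_of f); split=> // G' cG' pG'.
by have := fmax _ (codeP _ cG' pG'); rewrite /= sgraph_ofK.
Qed.

End Energy.

Theorem theorem3p6 (R : realType) (n : nat) (hn : 5 <= n) (G : sgraph n)
  (G_connected : connected_graph G)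
  (G_pendants : #|pendants G| = 3)
  (G_max : forall G' : sgraph n, connected_graph G' -> #|pendants G'| = 3 ->
     (rhoQ R G' <= rhoQ R G)%R) :
  isomorphic G (tree12 n).
Proof.
have n0 : 0 < n by apply: leq_trans hn.
have pG : 2 < #|pendants G| by rewrite G_pendants.
have [eG leG] := sup_eigenvalue n0 (dsl_mx_sym R G_connected).
have [x x0 fx] : exists2 x : 'rV[R]_n, (forall i, 0 < x 0 i)%R &
    bilin (dsl_mx R G) x x = (rhoQ R G * sqnorm x)%R.
  apply: (perron_vector (dsl_mx_sym R G_connected) _ _ eG leG) => i j.
    by rewrite dsl_mxE addr_ge0 // mulrn_wge0.
  move=> ij; rewrite dsl_mxE (negbTE ij) add0r ltr0n lt0n.
  by rewrite (dist_eq0 G_connected).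
have [M [cM pM maxM]] := energy_maximal_exists x G_connected pG.
have pM3 := maximal_pendants x0 cM pM maxM.
have [_ leM] := sup_eigenvalue n0 (dsl_mx_sym R cM).
(* [G] is energy-maximal too: [energy x G' <= energy x M <= 2 rhoQ(M) |x|^2 <= 2 rhoQ(G) |x|^2 =
   energy x G], the third inequality because [M] has exactly 3 pendant vertices. *)
apply: (maximal_isomorphic x0 G_connected pG _ hn) => G' cG' pG'.
apply: le_trans (maxM _ cG' pG') _.
rewrite !energy_bilin // lerMn2r /= fx; apply: le_trans (leM x) _.
by rewrite ler_wpM2r ?sqnorm_ge0 ?G_max.
Qed.
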